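(* Let $A$ be a closed subset of $\mathbb{R}^d$. The map $\beta\mapsto\operatorname{reach}_\beta(A)$ for $\beta\in\mathbb{R}^+$ is non-decreasing; moreover, $$\lim_{\beta\searrow 0}\operatorname{reach}_\beta(A)=\operatorname{reach}_0(A)=\operatorname{reach}(A).$$
   Context: $\mathbb{R}^d$ carries the Euclidean norm $\|\cdot\|_2$, $\mathbb{R}^+=(0,\infty)$, and $B(s,r)$ is the closed ball of radius $r$ centred at $s$. For non-empty $S\subseteq\mathbb{R}^d$, $\delta_S(t):=\inf\{\|t-s\|_2:s\in S\}$. For $r\geq 0$, $A_r:=\{x+y:x\in A,\ y\in B(0,r)\}$. The reach of $A\subseteq\mathbb{R}^d$ is $\operatorname{reach}(A):=\sup\{r\in\mathbb{R}^+:\forall y\in A_r\ \exists!\,x\in A\text{ nearest to }y\}\in[0,\infty]$, with the supremum of the empty set taken to be $0$. For $\alpha\in[0,\infty)$ and $x\in[0,\alpha/2]$, define $g_\alpha(x):=\frac{\alpha^2}{8x}+\frac{x}{2}$ if $x>0$, and $g_\alpha(0):=\infty$. For closed $A\subseteq\mathbb{R}^d$ and $\beta\in[0,\infty)$, the $\beta$-reach of $A$ is $$\operatorname{reach}_\beta(A):=\inf\left\{g_{\|a_2-a_1\|_2}(x): a_1,a_2\in A,\ x=\delta_A\left(\tfrac{a_1+a_2}{2}\right)\ge\beta\right\}\in[0,\infty],$$ with $\inf\emptyset=\infty$. (For $a_1,a_2\in A$ one always has $\delta_A(\frac{a_1+a_2}{2})\le\|a_2-a_1\|_2/2$, so the expression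 is well defined.) *)

(* Defs.v *)
From HB Require Import structures.
From mathcomp Require Import all_boot all_order all_algebra.
From mathcomp Require Import all_classical all_reals all_analysis.

Set Implicit Arguments.
Unset Strict Implicit.
Unset Printing Implicit Defensive.

Import Order.TTheory GRing.Theory Num.Theory.
Import numFieldNormedType.Exports.

Local Open Scope classical_set_scope.
Local Open Scope ring_scope.

(* The library norm on row vectors is the sup norm, hence this definition.
   Both norms induce the library topology of 'rV[R]_d, so [closed] needs no
   Euclidean counterpart. *)
Definition enorm (R : realType) (d : nat) (v : 'rV[R]_d) : R :=
  Num.sqrt (\sum_(i < d) v ord0 i ^+ 2).

Definition eball (R : realType) (d : nat) (s : 'rV[R]_d) (r : R) :
    set 'rV[R]_d :=
  [set t | enorm (t - s) <= r].

(* Meaningful for nonempty S only (inf set0 = 0). *)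
Definition setdist (R : realType) (d : nat) (S : set 'rV[R]_d)
    (t : 'rV[R]_d) : R :=
  inf [set enorm (t - s) | s in S].

Definition thickening (R : realType) (d : nat) (A : set 'rV[R]_d) (r : R) :
    set 'rV[R]_d :=
  [set z | exists x y, [/\ A x, eball 0 r y & z = x + y]].

Definition is_nearest (R : realType) (d : nat) (A : set 'rV[R]_d)
    (y x : 'rV[R]_d) : Prop :=
  A x /\ forall x', A x' -> enorm (y - x) <= enorm (y - x').

(* The supremum is taken in [0, +oo]: [maxe 0] only turns
   ereal_sup set0 = -oo into 0. *)
Definition reach (R : realType) (d : nat) (A : set 'rV[R]_d) : \bar R :=
  maxe 0%E (ereal_sup [set r%:E | r in [set r : R | 0 < r /\
    forall y, thickening A r y -> exists! x, is_nearest A y x]]).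

(* Used for 0 <= x <= alpha / 2 only. *)
Definition gfun (R : realType) (alpha x : R) : \bar R :=
  if 0 < x then (alpha ^+ 2 / (8 * x) + x / 2)%:E else +oo%E.

(* ereal_inf set0 = +oo. *)
Definition beta_reach (R : realType) (d : nat) (beta : R)
    (A : set 'rV[R]_d) : \bar R :=
  ereal_inf [set e | exists a1 a2 : 'rV[R]_d,
    let x := setdist A (2^-1 *: (a1 + a2)) in
    [/\ A a1, A a2, beta <= x & e = gfun (enorm (a2 - a1)) x]].

(* Main.v *)
Require Import Defs.
From HB Require Import structures.
From mathcomp Require Import all_boot all_order all_algebra.
From mathcomp Require Import all_classical all_reals all_analysis.
From mathcomp Require Import ring lra.

Set Implicit Arguments.
Unset Strict Implicit.
Unset Printing Implicit Defensive.

Import Order.TTheory GRing.Theory Num.Theory.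
Import numFieldNormedType.Exports.

Local Open Scope classical_set_scope.
Local Open Scope ring_scope.

(** The number [g_al(x) = al^2/(8x) + x/2] is the radius of the circle in
    which a chord of length [al] has sagitta [x].  Write [m] for the midpoint of
    [a1, a2] in [A], [al] for their distance and [x] for the distance from [m]
    to [A].  Both inequalities between [beta_reach 0 A] and [reach A] rest on
    the median identity [enorm_median],
      [|c - a1|^2 + |c - a2|^2 = 2 |c - m|^2 + al^2 / 2].

    If uniqueness of nearest points fails within distance [r] of [A], some [y]
    at distance [s <= r] has two nearest points [a1], [a2].  By the median
    identity [h = |y - m|] satisfies [s^2 = h^2 + al^2/4], and since the
    distance to [A] is 1-Lipschitz, [|x - s| <= h < s].  Hence [x > 0] and
    [g_al(x) <= s] ([two_nearest_chord]).

    Conversely, let nearest points be unique within distance [r] of [A] and let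
    [0 < x < r] (for [x >= r], simply [g_al(x) >= x >= r]).  If some [c] had
    [|c - m| <= r - x] and distance at least [r] to [A], the median identity
    would give [r^2 <= (r - x)^2 + al^2/4], that is [r <= g_al(x)]
    ([unique_nearest_chord]).  Such a [c], up to a small loss, is found by
    climbing:
    at a point with a unique nearest point, moving straight away from that
    nearest point increases the distance to [A] at unit rate
    ([setdist_ascent]).  Hence, for [th < 1], the function
    [c |-> setdist A c - th |c - m|] has no maximum in the interior of the ball
    of centre [m] and radius [r - x], and its maximum on that compact ball is
    reached on the boundary, where the distance to [A] is at least
    [x + th (r - x)] ([exists_far_point]).  Letting [th] tend to 1 concludes.
    This replaces the usual extension of normals, which follows a gradient
    flow of the distance function.

    The remaining claims are formal: a larger [beta] restricts the infimum to
    fewer pairs, and the pairs with [x = 0] contribute [+oo], so that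
    [beta_reach 0 A] is the infimum of [beta_reach beta A] over [beta > 0]. *)

(** * Euclidean norm *)

Definition dot (R : realType) (d : nat) (u v : 'rV[R]_d) : R :=
  \sum_(i < d) u ord0 i * v ord0 i.

Lemma enorm_ge0 (R : realType) (d : nat) (v : 'rV[R]_d) : 0 <= enorm v.
Proof. exact: sqrtr_ge0. Qed.

Lemma sqr_enorm (R : realType) (d : nat) (v : 'rV[R]_d) :
  enorm v ^+ 2 = dot v v.
Proof. by rewrite sqr_sqrtr ?sumr_ge0// => i _; exact: sqr_ge0. Qed.

Lemma enorm0 (R : realType) (d : nat) : enorm (0 : 'rV[R]_d) = 0.
Proof. by rewrite /enorm big1 ?sqrtr0// => i _; rewrite mxE expr0n. Qed.

Lemma enorm_eq0 (R : realType) (d : nat) (v : 'rV[R]_d) :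
  enorm v = 0 -> v = 0.
Proof.
move=> v0; apply/rowP => i; rewrite mxE.
have := sqr_enorm v; rewrite v0 expr0n/= => /esym/eqP.
rewrite psumr_eq0 => [/allP/(_ i (mem_index_enum i))|j _]; last exact: sqr_ge0.
by rewrite mulf_eq0 orbb => /eqP.
Qed.

Lemma enormZ (R : realType) (d : nat) (k : R) (v : 'rV[R]_d) :
  enorm (k *: v) = `|k| * enorm v.
Proof.
rewrite /enorm -sqrtr_sqr -sqrtrM ?sqr_ge0// mulr_sumr.
by congr Num.sqrt; apply: eq_bigr => i _; rewrite mxE exprMn.
Qed.

Lemma enormN (R : realType) (d : nat) (v : 'rV[R]_d) : enorm (- v) = enorm v.
Proof. by rewrite -scaleN1r enormZ normrN1 mul1r. Qed.

Lemma enormBC (R : realType) (d : nat) (u v : 'rV[R]_d) :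
  enorm (u - v) = enorm (v - u).
Proof. by rewrite -opprB enormN. Qed.

Lemma sqr_enormDZ (R : realType) (d : nat) (k : R) (u v : 'rV[R]_d) :
  enorm (u + k *: v) ^+ 2 =
  enorm u ^+ 2 + 2 * k * dot v u + k ^+ 2 * enorm v ^+ 2.
Proof.
rewrite !sqr_enorm /dot !mulr_sumr -!big_split/=.
by apply: eq_bigr => i _; rewrite !mxE; ring.
Qed.

(** Cauchy-Schwarz, without absolute value. *)
Lemma dot_le_enorm (R : realType) (d : nat) (u v : 'rV[R]_d) :
  dot u v <= enorm u * enorm v.
Proof.
have [u0|u0] := eqVneq (enorm u) 0.
  rewrite u0 mul0r (enorm_eq0 u0) /dot big1// => i _; by rewrite mxE mul0r.
have Npos : 0 < enorm u by rewrite lt_def u0 enorm_ge0.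
have [v0|v0] := eqVneq (enorm v) 0.
  rewrite v0 mulr0 (enorm_eq0 v0) /dot big1// => i _; by rewrite mxE mulr0.
have Mpos : 0 < enorm v by rewrite lt_def v0 enorm_ge0.
(* The multiple of [u] is scaled to the length of [v]: the squared norm of the
   difference is then a positive multiple of the gap to be bounded. *)
have := sqr_ge0 (enorm (v + (- (enorm v / enorm u)) *: u)).
rewrite sqr_enormDZ.
have -> : enorm v ^+ 2 + 2 * - (enorm v / enorm u) * dot u v
    + (- (enorm v / enorm u)) ^+ 2 * enorm u ^+ 2 =
    2 * (enorm v / enorm u) * (enorm u * enorm v - dot u v) by field.
by rewrite pmulr_rge0 ?subr_ge0// mulr_gt0// divr_gt0.
Qed.

Lemma enormD (R : realType) (d : nat) (u v : 'rV[R]_d) :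
  enorm (u + v) <= enorm u + enorm v.
Proof.
rewrite -(@ler_pXn2r _ 2%N) ?nnegrE ?addr_ge0 ?enorm_ge0//.
have := sqr_enormDZ 1 u v; rewrite scale1r => ->.
have := dot_le_enorm v u; rewrite sqrrD; lra.
Qed.

Lemma enorm_triangle (R : realType) (d : nat) (u v w : 'rV[R]_d) :
  enorm (u - w) <= enorm (u - v) + enorm (v - w).
Proof. by rewrite (le_trans _ (enormD _ _))// addrA subrK. Qed.

(** Apollonius' identity for the median from [c] of the triangle
    [c, a1, a2]. *)
Lemma enorm_median (R : realType) (d : nat) (a1 a2 c : 'rV[R]_d) :
  enorm (c - a1) ^+ 2 + enorm (c - a2) ^+ 2 =
  2 * enorm (c - 2^-1 *: (a1 + a2)) ^+ 2 + enorm (a2 - a1) ^+ 2 / 2.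
Proof.
rewrite !sqr_enorm /dot mulr_sumr mulr_suml -!big_split/=.
by apply: eq_bigr => i _; rewrite !mxE; field.
Qed.

(** * Continuity and compactness *)

(** Links the Euclidean norm to the sup norm, from which boundedness and the
    topology of row vectors are defined. *)
Lemma normr_le_enorm (R : realType) (d : nat) (v : 'rV[R]_d) :
  `|v| <= enorm v.
Proof.
rewrite [leLHS]/Num.norm/= mx_normrE; apply: bigmax_le => [|[i j] _ /=].
  exact: enorm_ge0.
rewrite -(@ler_pXn2r _ 2%N) ?nnegrE ?enorm_ge0// sqr_enorm /dot.
rewrite (bigD1 j)//= ord1 real_normK ?num_real// -expr2 lerDl.
by apply: sumr_ge0 => k _; exact: sqr_ge0.
Qed.

Lemma dot_continuous (R : realType) (d : nat) (u c : 'rV[R]_d) :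
  continuous (fun q : 'rV[R]_d => dot u (c - q)).
Proof.
rewrite /dot; apply: continuous_big => [|i _ q]; first exact: add_continuous.
apply: (@continuous_comp _ _ _ (fun q : 'rV[R]_d => c - q)
  (fun v : 'rV[R]_d => u ord0 i * v ord0 i)).
  by apply: continuousB; [exact: cst_continuous|exact: cvg_id].
by apply: continuousM; [exact: cst_continuous|exact: coord_continuous].
Qed.

Lemma enorm_continuous (R : realType) (d : nat) :
  continuous (@enorm R d).
Proof.
move=> v; apply: (continuous_comp _ (@sqrt_continuous _ _)).
move: v; apply: continuous_big => [|i _ q]; first exact: add_continuous.
by apply: continuousM; exact: coord_continuous.
Qed.

Lemma lipschitz_enorm_continuous (R : realType) (d : nat)
    (f : 'rV[R]_d -> R) (k : R) :
  (forall u v, f u - f v <= k * enorm (u - v)) -> continuous f.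
Proof.
move=> flip x.
have fd y : `|f x - f y| <= k * enorm (x - y).
  by rewrite ler_norml flip lerNl opprB enormBC flip.
have cv : {for x, continuous (fun y : 'rV[R]_d => k * enorm (x - y))}.
  apply: continuousM; first exact: cst_continuous.
  apply: (@continuous_comp _ _ _ (fun y : 'rV[R]_d => x - y)).
    by apply: continuousB; [exact: cst_continuous|exact: cvg_id].
  exact: enorm_continuous.
rewrite /prop_for /continuous_at subrr enorm0 mulr0 in cv.
have FF : Filter (nbhs x) := nbhs_filter x.
apply/(@cvgrPdist_le _ _ _ (nbhs x)) => e e0.
have := @cvgr_dist_le _ _ _ (nbhs x) FF _ _ cv e e0.
apply: filterS => y; rewrite sub0r normrN => h; rewrite (le_trans (fd y))//.
by rewrite (le_trans _ h)// ler_norm.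
Qed.

Lemma eball_compact (R : realType) (d : nat) (c : 'rV[R]_d) (r : R) :
  compact (eball c r).
Proof.
apply: bounded_closed_compact.
  exists (enorm c + r); split; first exact: num_real.
  move=> M ltM v /= cv; apply: le_trans (ltW ltM).
  rewrite (le_trans (normr_le_enorm v))// -{1}[v](subrK c) addrC.
  by rewrite (le_trans (enormD _ _))// lerD2l.
apply: (@preimage_closed _ _ (fun v : 'rV[R]_d => enorm (v - c))
  [set x | x <= r]).
  move=> v _; move: v; apply: (@lipschitz_enorm_continuous _ _ _ 1) => u v.
  have := enorm_triangle u v c; lra.
exact: closed_le.
Qed.
(** * Distance to a closed set *)

Lemma exists_nearest (R : realType) (d : nat) (A : set 'rV[R]_d)
    (y : 'rV[R]_d) : closed A -> A !=set0 -> exists x, is_nearest A y x.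
Proof.
move=> Acl [a Aa]; pose K := A `&` eball y (enorm (y - a)).
have Kc : compact K.
  rewrite /K setIC; apply: (@subclosed_compact _ _ (eball y (enorm (y - a)))).
  - apply: closedI => //; apply: compact_closed; last exact: eball_compact.
    exact: norm_hausdorff.
  - exact: eball_compact.
  - by move=> z [].
have K0 : K !=set0 by exists a; split => //=; rewrite /eball/= enormBC.
have [|x] := compact_EVT_min K0 Kc (f := fun x : 'rV[R]_d => enorm (y - x)).
  apply: continuous_subspaceT.
  apply: (@lipschitz_enorm_continuous _ _ _ 1) => u v.
  have := enorm_triangle y v u; rewrite (enormBC v u); lra.
rewrite inE => -[Ax /= xa] xmin; exists x; split => // x' Ax'.
have [x'K|x'K] := leP (enorm (y - x')) (enorm (y - a)).
  by apply: xmin; apply/mem_set; split; rewrite // /eball/= (enormBC x').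
by rewrite (le_trans _ (ltW x'K))// (enormBC y x).
Qed.

Lemma setdist_le (R : realType) (d : nat) (A : set 'rV[R]_d)
    (t a : 'rV[R]_d) : A a -> setdist A t <= enorm (t - a).
Proof.
move=> Aa; apply: ge_inf; last by exists a.
by exists 0 => _ [s _ <-]; exact: enorm_ge0.
Qed.

Lemma le_setdist (R : realType) (d : nat) (A : set 'rV[R]_d)
    (t : 'rV[R]_d) (l : R) : A !=set0 ->
  (forall a, A a -> l <= enorm (t - a)) -> l <= setdist A t.
Proof.
move=> [a Aa] lA; apply: lb_le_inf; first by exists (enorm (t - a)), a.
by move=> _ [s As <-]; exact: lA.
Qed.

Lemma setdist_ge0 (R : realType) (d : nat) (A : set 'rV[R]_d)
    (t : 'rV[R]_d) : A !=set0 -> 0 <= setdist A t.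
Proof. by move=> A0; apply: le_setdist => // a _; exact: enorm_ge0. Qed.

Lemma setdist_lipschitz (R : realType) (d : nat) (A : set 'rV[R]_d)
    (s t : 'rV[R]_d) : A !=set0 ->
  setdist A s <= setdist A t + enorm (s - t).
Proof.
move=> A0; rewrite -lerBlDr; apply: le_setdist => // a Aa.
by rewrite lerBlDr addrC (le_trans (setdist_le _ Aa))// enorm_triangle.
Qed.

Lemma nearestP (R : realType) (d : nat) (A : set 'rV[R]_d)
    (y x : 'rV[R]_d) :
  is_nearest A y x <-> A x /\ enorm (y - x) = setdist A y.
Proof.
split=> -[Ax xy]; split=> //.
  apply/eqP; rewrite eq_le setdist_le// andbT.
  by apply: le_setdist => //; exists x.
by move=> x' Ax'; rewrite xy setdist_le.
Qed.

(** The infimum in [setdist] is attained, hence the closed inequality. *)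
Lemma thickeningP (R : realType) (d : nat) (A : set 'rV[R]_d) (r : R)
    (y : 'rV[R]_d) : closed A -> A !=set0 ->
  thickening A r y <-> setdist A y <= r.
Proof.
move=> Acl A0; split.
  move=> [x [v [Ax]]]; rewrite /eball/= subr0 => vr ->.
  by rewrite (le_trans (setdist_le _ Ax))// addrC addKr.
have [x /nearestP[Ax <-] xr] := exists_nearest y Acl A0.
by exists x, (y - x); rewrite /eball/= subr0 subrKC.
Qed.
(** * Escaping from a set with unique nearest points *)

(** Let [D] be the distance from [c] to [A].  The points [q] of [A] for which
    [c - q] has a component at most [th D] along [c - p] form a closed set that
    misses [p], the only nearest point: they stay at distance at least
    [D + 2 e0] from [c], and a move of length [e <= e0] leaves them at distance
    at least [D + e].  For every other [q] the move adds at least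
    [2 e th D + e^2] to the squared distance, which brings it above
    [(D + th e)^2].  The move has length [e] because [c - p] has length [D]. *)
Lemma setdist_ascent (R : realType) (d : nat) (A : set 'rV[R]_d)
    (c p : 'rV[R]_d) (th : R) : closed A -> is_nearest A c p ->
  (forall q, is_nearest A c q -> q = p) -> 0 < setdist A c ->
  0 <= th < 1 ->
  exists2 e0, 0 < e0 & forall e, 0 < e <= e0 ->
    setdist A c + th * e <=
    setdist A (c + (e / setdist A c) *: (c - p)).
Proof.
move=> Acl cp puniq D0 /andP[th0 th1].
have /nearestP[Ap cpD] := cp.
set D := setdist A c in cpD D0 *.
have A0 : A !=set0 by exists p.
pose F := A `&` [set q | dot (c - p) (c - q) <= th * D ^+ 2].
have Fcl : closed F.
  apply: closedI => //.
  apply: (@preimage_closed _ _ (fun q : 'rV[R]_d => dot (c - p) (c - q))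
    [set x | x <= th * D ^+ 2]); last exact: closed_le.
  by move=> q _; exact: dot_continuous.
have [e0 e0gt e0F] : exists2 e0, 0 < e0 &
    forall q, F q -> D + 2 * e0 <= enorm (c - q).
  have [F0|F0] := pselect (F !=set0); last first.
    by exists 1 => // q Fq; exfalso; apply: F0; exists q.
  have [f [[Af /= fp] fmin]] := exists_nearest c Fcl F0.
  exists ((enorm (c - f) - D) / 2); last first.
    by move=> q Fq; have := fmin q Fq; lra.
  rewrite divr_gt0// subr_gt0 lt_def setdist_le// andbT.
  apply/negP => /eqP fD.
  move: fp; rewrite (puniq f); last by apply/nearestP.
  rewrite -sqr_enorm cpD leNgt => /negP; apply.
  by rewrite gtr_pMl// exprn_gt0.
exists e0 => // e /andP[egt0 ee0].
set c' := c + _ *: _.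
have step : enorm (c' - c) = e.
  by rewrite /c' addrC addKr enormZ cpD gtr0_norm ?divr_gt0// divfK// gt_eqF.
apply: le_setdist => // q Aq.
have Dq : D <= enorm (c - q) := setdist_le c Aq.
have [qF|qF] := leP (dot (c - p) (c - q)) (th * D ^+ 2).
  have := e0F q (conj Aq qF); have := enorm_triangle c c' q.
  rewrite (enormBC c c') step.
  have : th * e <= e by rewrite ler_piMl ?ltW.
  lra.
have lhs0 : 0 <= D + th * e by rewrite addr_ge0 ?mulr_ge0// ltW.
rewrite -(@ler_pXn2r _ 2%N) ?nnegrE ?enorm_ge0//.
rewrite /c' addrAC sqr_enormDZ cpD.
have -> : (e / D) ^+ 2 * D ^+ 2 = e ^+ 2.
  by rewrite -exprMn divfK// gt_eqF.
have h1 : 2 * e * (th * D) <= 2 * (e / D) * dot (c - p) (c - q).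
  have -> : 2 * e * (th * D) = 2 * (e / D) * (th * D ^+ 2).
    by field; rewrite gt_eqF.
  by apply: ler_wpM2l; [rewrite mulr_ge0// divr_ge0// ltW|exact: ltW].
have h2 : D ^+ 2 <= enorm (c - q) ^+ 2.
  by apply: lerXn2r Dq; rewrite nnegrE ?enorm_ge0// ltW.
have h3 : (th * e) ^+ 2 <= e ^+ 2.
  by rewrite exprMn ler_piMl ?sqr_ge0// expr_le1//; exact: ltW.
have -> : (D + th * e) ^+ 2 = D ^+ 2 + 2 * e * (th * D) + (th * e) ^+ 2.
  by ring.
by rewrite lerD// lerD.
Qed.

(** The maximum of [setdist A c - th |c - y|] over the ball cannot be interior:
    there, [setdist_ascent] at a rate strictly between [th] and 1 would
    increase it. *)
Lemma exists_far_point (R : realType) (d : nat) (A : set 'rV[R]_d) (r : R)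
    (y : 'rV[R]_d) (th : R) : closed A -> A !=set0 ->
  (forall c, setdist A c < r -> exists! p, is_nearest A c p) ->
  0 < setdist A y < r -> 0 <= th < 1 ->
  exists2 c, enorm (c - y) <= r - setdist A y &
    setdist A y + th * (r - setdist A y) <= setdist A c.
Proof.
move=> Acl A0 Auniq /andP[x0 xr] /andP[th0 th1].
set x := setdist A y in x0 xr *; set L := r - x.
have L0 : 0 < L by rewrite subr_gt0.
pose phi c := setdist A c - th * enorm (c - y).
have B0 : eball y L !=set0.
  by exists y; rewrite /eball/= subrr enorm0 ltW.
have [|c] := compact_EVT_max B0 (@eball_compact _ _ y L) (f := phi).
  apply: continuous_subspaceT.
  apply: (@lipschitz_enorm_continuous _ _ _ (1 + th)) => u v.
  have h1 := @setdist_lipschitz _ _ A u v A0.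
  have h2 : enorm (v - y) - enorm (u - y) <= enorm (u - v).
    by have := enorm_triangle v u y; rewrite (enormBC v u); lra.
  have := ler_wpM2l th0 h2; rewrite /phi; lra.
rewrite inE => cL cmax.
have phiy : x <= phi c.
  rewrite (le_trans _ (cmax y _))//.
    by rewrite /phi subrr enorm0 mulr0 subr0.
  by rewrite inE /eball/= subrr enorm0 ltW.
exists c => //.
have {cL}[cL|cL] : enorm (c - y) = L \/ enorm (c - y) < L.
  by move: cL; rewrite /eball/= le_eqVlt => /orP[/eqP|]; [left|right].
  by rewrite -cL -lerBrDr.
(* An interior maximum is still close enough to [A] for its nearest point to be
   unique, and it is off [A] since the maximum exceeds the value at [y]. *)
exfalso.
have Dr : setdist A c < r.
  have := @setdist_lipschitz _ _ A c y A0; rewrite -/x; move: cL; rewrite /L.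
  lra.
have D0 : 0 < setdist A c.
  apply: lt_le_trans x0 _; rewrite (le_trans phiy)// /phi gerBl.
  by rewrite mulr_ge0// enorm_ge0.
have [p [cp puniq]] := Auniq c Dr.
have cpD : enorm (c - p) = setdist A c by case/nearestP: cp.
have th1' : 0 <= (1 + th) / 2 < 1 by apply/andP; split; lra.
have [e0 e0gt e0P] := setdist_ascent Acl cp
  (fun q hq => esym (puniq q hq)) D0 th1'.
pose e := Num.min e0 (L - enorm (c - y)).
have egt : 0 < e by rewrite lt_min e0gt subr_gt0.
have [ee0 eL] : e <= e0 /\ e <= L - enorm (c - y).
  by split; rewrite ge_min lexx ?orbT.
have /e0P : 0 < e <= e0 by rewrite egt.
set c' := c + _ *: _.
have step : enorm (c' - c) = e.
  by rewrite /c' addrC addKr enormZ cpD gtr0_norm ?divr_gt0// divfK// gt_eqF.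
have c'y : enorm (c' - y) <= enorm (c - y) + e.
  by have := enorm_triangle c' c y; rewrite step; lra.
have : phi c' <= phi c.
  by apply: cmax; rewrite inE /eball/=; lra.
have := ler_wpM2l th0 c'y.
have : 0 < (1 - th) * e by rewrite mulr_gt0// subr_gt0.
by rewrite /phi; lra.
Qed.
(** * Chords and the radius of the circle through their arc *)

(** By Pythagoras' theorem, equality on the right says that [al] is the length
    of the chord at distance [|r - x|] from the centre of a circle of radius
    [r]. *)
Lemma le_chord_radiusE (R : realType) (r al x : R) : 0 < x ->
  (r <= al ^+ 2 / (8 * x) + x / 2) = (r ^+ 2 <= (r - x) ^+ 2 + al ^+ 2 / 4).
Proof.
move=> x0; rewrite -subr_ge0 -[RHS]subr_ge0.
have -> : (r - x) ^+ 2 + al ^+ 2 / 4 - r ^+ 2 =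
    (2 * x) * (al ^+ 2 / (8 * x) + x / 2 - r) by field; rewrite gt_eqF.
by rewrite pmulr_rge0// mulr_gt0.
Qed.

Lemma unique_nearest_chord (R : realType) (d : nat) (A : set 'rV[R]_d) (r : R)
    (a1 a2 : 'rV[R]_d) : closed A -> A a1 -> A a2 ->
  (forall c, setdist A c < r -> exists! p, is_nearest A c p) ->
  let x := setdist A (2^-1 *: (a1 + a2)) in
  0 < x -> r <= enorm (a2 - a1) ^+ 2 / (8 * x) + x / 2.
Proof.
move=> Acl Aa1 Aa2 Auniq; set m := 2^-1 *: _ => x x0.
have A0 : A !=set0 by exists a1.
set al := enorm _.
rewrite le_chord_radiusE//.
(* Beyond [r] nothing is known about nearest points, but the sagitta is at most
   half the chord, so that the radius is at least [x]. *)
have [rx|xr] := leP r x.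
  have h1 := setdist_le m Aa1; have h2 := setdist_le m Aa2.
  have := enorm_median a1 a2 m; rewrite -/m subrr enorm0 expr0n/= mulr0 add0r.
  have sq a : x <= enorm (m - a) -> x ^+ 2 <= enorm (m - a) ^+ 2.
    by move=> xa; apply: lerXn2r xa; rewrite nnegrE ?enorm_ge0//; exact: ltW.
  have {h1}h1 := sq _ h1; have {h2}h2 := sq _ h2.
  rewrite -/al => E.
  have [r0|r0] := leP r 0.
    have : 0 <= x * (x - 2 * r) by rewrite mulr_ge0 ?ltW//; lra.
    have := sqr_ge0 al; rewrite sqrrB; nra.
  nra.
set L := r - x; have L0 : 0 < L by rewrite subr_gt0.
have r0 : 0 < r by apply: lt_trans xr.
apply/ler_addgt0Pr => e e0.
have rL0 : 0 < 2 * r * L by rewrite !mulr_gt0.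
have den0 : 0 < e + 2 * r * L by rewrite addr_gt0.
(* Chosen so that [(1 - th) * 2 r L], which bounds the loss in [r ^ 2] caused by
   [th < 1], is at most [e], while keeping [0 <= th < 1] for every [e]. *)
pose th := 1 - e / (e + 2 * r * L).
have q01 : 0 < e / (e + 2 * r * L) <= 1.
  by rewrite divr_gt0//= ler_pdivrMr// mul1r lerDl ltW.
have th01 : 0 <= th < 1 by rewrite /th; apply/andP; lra.
have thE : (1 - th) * (2 * r * L) <= e.
  have -> : (1 - th) = e / (e + 2 * r * L) by rewrite /th; ring.
  by rewrite mulrAC ler_pdivrMr// ler_wpM2l ?ltW// ltrDr.
have x0r : 0 < setdist A m < r by rewrite -/x x0.
have [c cL cx] := exists_far_point Acl A0 Auniq x0r th01.
rewrite -/x -/L in cL cx.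
have [th0 th1] := andP th01.
have s0 : 0 <= x + th * L by rewrite addr_ge0 ?mulr_ge0//; exact: ltW.
have far a : A a -> (x + th * L) ^+ 2 <= enorm (c - a) ^+ 2.
  move=> Aa; have ca := le_trans cx (setdist_le c Aa).
  by apply: lerXn2r ca; rewrite nnegrE ?enorm_ge0.
have h1 := far _ Aa1; have h2 := far _ Aa2.
have := enorm_median a1 a2 c; rewrite -/m -/al => E.
have h3 : enorm (c - m) ^+ 2 <= L ^+ 2.
  by apply: lerXn2r cL; rewrite nnegrE ?enorm_ge0//; exact: ltW.
have : r ^+ 2 <= (x + th * L) ^+ 2 + e.
  rewrite (le_trans _ (lerD (lexx _) thE))//.
  have -> : x + th * L = r - (1 - th) * L by rewrite /L; ring.
  rewrite sqrrB; have := sqr_ge0 ((1 - th) * L); lra.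
lra.
Qed.

(** The distance [s] from [y] to [A], the half-chord and [h = |y - m|] form a
    right triangle, and [g_al(x) <= s] amounts to [(s - x)^2 <= h^2], which is
    the Lipschitz property of the distance between [y] and [m]. *)
Lemma two_nearest_chord (R : realType) (d : nat) (A : set 'rV[R]_d)
    (y a1 a2 : 'rV[R]_d) : is_nearest A y a1 -> is_nearest A y a2 ->
  a1 != a2 ->
  let x := setdist A (2^-1 *: (a1 + a2)) in
  0 < x /\ enorm (a2 - a1) ^+ 2 / (8 * x) + x / 2 <= setdist A y.
Proof.
move=> /nearestP[Aa1 y1] /nearestP[Aa2 y2] a12; set m := 2^-1 *: _ => x.
have A0 : A !=set0 by exists a1.
set al := enorm (a2 - a1); set s := setdist A y in y1 y2 *.
have al0 : 0 < al.
  rewrite lt_def enorm_ge0 andbT; apply: contra a12 => /eqP/enorm_eq0/eqP.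
  by rewrite subr_eq0 eq_sym.
have := enorm_median a1 a2 y; rewrite y1 y2 -/m -/al; set h := enorm _ => E.
have h0 : 0 <= h := enorm_ge0 _.
have s0 : 0 <= s := setdist_ge0 y A0.
have al20 : 0 < al ^+ 2 by rewrite exprn_gt0.
have hs : h < s by rewrite -(@ltr_pXn2r _ 2%N) ?nnegrE//; lra.
have xs1 : s - x <= h.
  by have := @setdist_lipschitz _ _ A y m A0; rewrite -/s -/x -/h; lra.
have xs2 : x - s <= h.
  by have := @setdist_lipschitz _ _ A m y A0; rewrite enormBC -/s -/x -/h; lra.
have x0 : 0 < x by lra.
split => //; rewrite -subr_le0.
have -> : al ^+ 2 / (8 * x) + x / 2 - s =
   ((s - x) ^+ 2 - h ^+ 2) / (2 * x).
  have -> : al ^+ 2 = 4 * (s ^+ 2 - h ^+ 2) by lra.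
  by field; rewrite gt_eqF.
rewrite pmulr_lle0 ?invr_gt0 ?mulr_gt0//.
have -> : (s - x) ^+ 2 - h ^+ 2 = (s - x - h) * (s - x + h) by ring.
by rewrite mulr_le0_ge0//; lra.
Qed.

(** * Reach and beta-reach *)

Lemma beta_reach_le (R : realType) (d : nat) (A : set 'rV[R]_d) (b1 b2 : R) :
  b1 <= b2 -> (beta_reach b1 A <= beta_reach b2 A)%E.
Proof.
move=> b12; apply: ereal_inf_le_tmp => _ [a1 [a2 [Aa1 Aa2 b2x ->]]].
by exists a1, a2; split => //; exact: le_trans b2x.
Qed.

(** A pair whose midpoint is at distance [x > 0] from [A] is already counted in
    [beta_reach x A], and a pair whose midpoint is in [A] contributes [+oo]. *)
Lemma beta_reach_cvg0 (R : realType) (d : nat) (A : set 'rV[R]_d) :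
  beta_reach beta A @[beta --> 0^'+] --> beta_reach 0 A.
Proof.
have := @nondecreasing_at_right_cvge R (fun b => beta_reach b A) 0 +oo%O isT
  (fun b1 b2 _ _ => @beta_reach_le R d A b1 b2).
congr (_ --> _); apply/eqP; rewrite eq_le; apply/andP; split.
  apply: le_ereal_inf_tmp => _ [a1 [a2 [Aa1 Aa2 x0 ->]]].
  rewrite /gfun; case: ifPn => [xgt0|_]; last exact: leey.
  set x := setdist _ _ in x0 xgt0 *.
  apply: le_trans (ereal_inf_lbound _) _.
    by exists x => //; rewrite /= in_itv/= xgt0.
  apply: ereal_inf_lbound; exists a1, a2; split => //.
  by rewrite /gfun xgt0.
apply: le_ereal_inf_tmp => _ [b + <-]; rewrite /= in_itv/= andbT => b0.
exact/beta_reach_le/ltW.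
Qed.

Lemma beta_reach0_le_of_not_unique (R : realType) (d : nat)
    (A : set 'rV[R]_d) (r : R) : closed A ->
  ~ (forall y, thickening A r y -> exists! x, is_nearest A y x) ->
  (beta_reach 0 A <= r%:E)%E.
Proof.
move=> Acl /existsNP[y /not_implyP[Ary nuniq]].
have A0 : A !=set0 by case: Ary => x [_ [Ax _ _]]; exists x.
have yr : setdist A y <= r by apply/(thickeningP r y Acl A0).
have [a1 ya1] := exists_nearest y Acl A0.
have [a2 ya2 a12] : exists2 a2, is_nearest A y a2 & a1 != a2.
  apply: contrapT => none; apply: nuniq; exists a1; split => // a2 ya2.
  by apply/eqP/negPn/negP => a12; apply: none; exists a2.
have [x0 xy] := two_nearest_chord ya1 ya2 a12.
apply: le_trans (ereal_inf_lbound _) _.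
  exists a1, a2; split; [by case: ya1|by case: ya2|exact: ltW|by []].
by rewrite /gfun x0 lee_fin (le_trans xy).
Qed.

Lemma beta_reach0E (R : realType) (d : nat) (A : set 'rV[R]_d) :
  closed A -> beta_reach 0 A = reach A.
Proof.
move=> Acl; apply/eqP; rewrite eq_le; apply/andP; split; last first.
  rewrite /reach ge_max; apply/andP; split.
    apply: le_ereal_inf_tmp => _ [a1 [a2 [_ _ x0 ->]]].
    rewrite /gfun; case: ifP => // _; rewrite lee_fin.
    by rewrite addr_ge0// divr_ge0 ?sqr_ge0// mulr_ge0.
  apply: ge_ereal_sup => _ [r [r0 Auniq] <-].
  apply: le_ereal_inf_tmp => _ [a1 [a2 [Aa1 Aa2 _ ->]]].
  rewrite /gfun; case: ifP => [x0|_]; last exact: leey.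
  have A0 : A !=set0 by exists a1.
  rewrite lee_fin; apply: unique_nearest_chord => // c /ltW cr.
  exact/Auniq/thickeningP.
have reach0 : (0 <= reach A)%E by rewrite /reach le_max lexx.
case E : (reach A) reach0 => [s| |] // s0; last exact: leey.
apply/lee_addgt0Pr => e e0; rewrite -EFinD.
have r0 : 0 < s + e by rewrite ltr_wpDl.
apply: beta_reach0_le_of_not_unique => // Auniq.
have : ((s + e)%:E <= reach A)%E.
  by rewrite /reach le_max ereal_sup_ubound ?orbT//; exists (s + e).
by rewrite E lee_fin leNgt ltrDl e0.
Qed.

Theorem theorem2 (R : realType) (d : nat) (A : set 'rV[R]_d)
    (Aclosed : closed A) :
  [/\ forall beta1 beta2 : R, 0 < beta1 -> beta1 <= beta2 ->
        (beta_reach beta1 A <= beta_reach beta2 A)%E,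
      beta_reach beta A @[beta --> 0^'+] --> beta_reach 0 A
    & beta_reach 0 A = reach A].
Proof.
split.
- by move=> beta1 beta2 _; exact: beta_reach_le.
- exact: beta_reach_cvg0.
- exact: beta_reach0E.
Qed.
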